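(* For all sufficiently small $\gamma > 0$, there is a triangular graph $H$ with $$\frac{\tau_1(H)}{|E(H)|} \geq \frac{3-\sqrt{5}}{2} - \gamma > 0.38 \quad\text{and}\quad \frac{\alpha_1(H)}{|E(H)|} \geq \frac{1}{\sqrt{5}} - \gamma > 0.44.$$
   Context: Graphs are finite and simple. $E(H)$ denotes the edge set of $H$. A triangle independent set in a graph $H$ is a set of edges of $H$ containing at most one edge from each triangle of $H$; $\alpha_1(H)$ denotes the size of a largest triangle independent set in $H$. A triangle edge cover in $H$ is a set of edges of $H$ containing at least one edge from each triangle of $H$ (equivalently, a set of edges whose deletion makes $H$ triangle-free); $\tau_1(H)$ denotes the size of a smallest triangle edge cover in $H$. A graph is triangular if every edge lies in some triangle. Ratios with denominator $|E(H)|$ presuppose that $H$ has at least one edge. *)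

(* Defs.v *)
From HB Require Import structures.
From mathcomp Require Import all_boot all_order all_algebra.
From mathcomp Require Import reals.

Set Implicit Arguments.
Unset Strict Implicit.
Unset Printing Implicit Defensive.

Record sgraph := SGraph {
  vertex :> finType;
  adj : rel vertex;
  adj_sym : symmetric adj;
  adj_irrefl : irreflexive adj
}.

Section TriangleParameters.
Variable H : sgraph.

Definition edges : {set {set H}} :=
  [set e | [exists x, exists y, adj x y && (e == [set x; y])]].

(* A triangle is represented by its set of three pairwise adjacent vertices. *)
Definition is_triangle (t : {set H}) : bool :=
  (#|t| == 3) && [forall x in t, forall y in t, (x != y) ==> adj x y].

Definition triangle_edges (t : {set H}) : {set {set H}} :=
  [set e in edges | e \subset t].

Definition triangle_independent (F : {set {set H}}) : bool :=
  (F \subset edges) &&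
  [forall t, is_triangle t ==> (#|F :&: triangle_edges t| <= 1)].

Definition triangle_edge_cover (F : {set {set H}}) : bool :=
  (F \subset edges) &&
  [forall t, is_triangle t ==> (1 <= #|F :&: triangle_edges t|)].

Definition triangular : bool :=
  [forall e in edges, exists t, is_triangle t && (e \in triangle_edges t)].

Definition alpha1 : nat :=
  \max_(F : {set {set H}} | triangle_independent F) #|F|.

(* The default value [edges] of the arg min is itself a triangle edge cover, *)
(* see [triangle_edge_cover_edges].                                          *)
Definition tau1 : nat :=
  #|[arg min_(F < edges | triangle_edge_cover F) #|F|]|.

Lemma triangle_edge_cover_edges : triangle_edge_cover edges.
Proof.
rewrite /triangle_edge_cover subxx /=; apply/forallP=> t; apply/implyP.
case/andP=> /eqP t3 /forall_inP tadj.
have /card_gt1P[x [y [xt yt xy]]] : 1 < #|t| by rewrite t3.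
apply/card_gt0P; exists [set x; y].
have xyE : [set x; y] \in edges.
  rewrite inE; apply/existsP; exists x; apply/existsP; exists y.
  by rewrite eqxx andbT (implyP (forall_inP (tadj x xt) y yt)).
rewrite in_setI xyE in_set xyE /=.
by apply/subsetP=> z; rewrite !inE => /orP[] /eqP->.
Qed.

Lemma tau1_le (F : {set {set H}}) : triangle_edge_cover F -> tau1 <= #|F|.
Proof.
rewrite /tau1; case: arg_minnP => [|G _ Gmin /Gmin //].
exact: triangle_edge_cover_edges.
Qed.

Lemma tau1_attained : exists2 F, triangle_edge_cover F & #|F| = tau1.
Proof.
rewrite /tau1; case: arg_minnP => [|G Gcov _]; last by exists G.
exact: triangle_edge_cover_edges.
Qed.

End TriangleParameters.

(* Main.v *)
Require Import Defs.
From mathcomp Require Import all_boot all_order all_algebra all_field.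
From mathcomp Require Import reals.
From mathcomp Require Import ring lra.

Import Order.TTheory GRing.Theory Num.Theory.

Set Implicit Arguments.
Unset Strict Implicit.
Unset Printing Implicit Defensive.

Local Open Scope ring_scope.

(** The graph [H] is the join of a triangle-free pseudo-random graph [B], with
    [n] vertices and [m] edges, and an independent set [A] of size [a]: it has
    [m + a n] edges.

    Every triangle of [H] has exactly two vertices in [B], so the [m] edges of
    [B] form a triangle independent set ([alpha1_join]).  For a triangle
    edge cover and a vertex [w] of [A], let [S] be the set of vertices of [B]
    whose edge to [w] is not in the cover: each edge of [B] inside [S] forms
    with [w] a triangle, so it is in the cover.  Averaging over [w], a cover has
    at least [min_S (e(S) + a (n - |S|))] edges ([tau1_join]).

    Pseudo-randomness means that a set of [x n] vertices spans at least
    [(x^2 - o(1)) m] edges.  With [a n = b m], the minimum over [x] of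
    [x^2 m + (1 - x) b m] is [(b - b^2/4) m], at [x = b/2]; thus
    [alpha1 / |E| >= 1 / (1 + b)] and
    [tau1 / |E| >= (b - b^2/4) / (1 + b) - o(1)].  The choice [b = sqrt 5 - 1]
    turns these into [1 / sqrt 5] and [(3 - sqrt 5) / 2].

    The graph [B] is the Cayley graph of the plane [F * F] over a finite field
    of order [q], with generators [(x, x^2)] and [- (x, x^2)] for [x != 0].  In
    odd characteristic a sum of three generators vanishes only if
    [x^2 + x y + y^2] has a nontrivial zero, which is impossible when [F] has no
    primitive cube root of unity; the fields of order [5^(2N+1)] qualify
    ([large_field]).  Two distinct points of the plane lie on at most one common
    translate of the parabola, so the number of points of [S] on a translate has
    small variance, and Cauchy--Schwarz gives the lower bound on [e(S)] with an
    error of order [m / sqrt q] ([sum_hits_in_ge]). *)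

(** * Graphs and counting *)

Lemma card_slices (I J : finType) (X : {set I * J}) :
  #|X| = (\sum_i #|[set j | (i, j) \in X]|)%N.
Proof.
rewrite -sum1_card (eq_bigr (fun i => \sum_(j | (i, j) \in X) 1)%N).
  by rewrite pair_big_dep; apply: eq_bigl => -[].
by move=> i _; rewrite sum1dep_card.
Qed.

Definition triangle_free (B : sgraph) :=
  forall x y z : B, adj x y -> adj y z -> adj x z -> False.

Definition induced_edges (B : sgraph) (S : {set B}) : {set {set B}} :=
  [set e in edges B | e \subset S].

Lemma edgesP (B : sgraph) (e : {set B}) :
  reflect (exists x y, adj x y /\ e = [set x; y]) (e \in edges B).
Proof.
rewrite inE; apply: (iffP existsP) => [[x /existsP[y /andP[xy /eqP->]]]|].
  by exists x, y.
by case=> x [y [xy ->]]; exists x; apply/existsP; exists y; rewrite xy eqxx.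
Qed.

Lemma mem_edges2 (B : sgraph) (x y : B) : adj x y -> [set x; y] \in edges B.
Proof. by move=> xy; apply/edgesP; exists x, y. Qed.

Lemma adj_neq (B : sgraph) (x y : B) : adj x y -> x != y.
Proof. by move=> xy; apply/eqP=> e; rewrite e adj_irrefl in xy. Qed.

Lemma is_triangle3 (B : sgraph) (x y z : B) :
  adj x y -> adj y z -> adj x z -> is_triangle [set x; y; z].
Proof.
move=> xy yz xz; apply/andP; split.
  by rewrite setUC cardsU1 !inE cards2 (adj_neq xy)
    !(eq_sym z) (negPf (adj_neq xz)) (negPf (adj_neq yz)).
have [yx zy zx] : [/\ adj y x, adj z y & adj z x].
  by rewrite ![adj _ x]adj_sym [adj z y]adj_sym.
apply/forall_inP=> u /setUP[/set2P[]|/set1P]-> ; apply/forall_inP=> v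
  /setUP[/set2P[]|/set1P]->; by rewrite ?eqxx //; apply/implyP.
Qed.

(** * The join with an independent set *)

Section Join.
Variables (B : sgraph) (a : nat).

Definition join_adj (p q : B + 'I_a) : bool :=
  match p, q with
  | inl x, inl y => adj x y
  | inr _, inr _ => false
  | _, _ => true
  end.

Lemma join_adj_sym : symmetric join_adj.
Proof. by case=> x [] y //=; rewrite adj_sym. Qed.

Lemma join_adj_irrefl : irreflexive join_adj.
Proof. by case=> x //=; rewrite adj_irrefl. Qed.

Definition join : sgraph := SGraph join_adj_sym join_adj_irrefl.

Definition base_edge (e : {set B}) : {set join} := [set inl x | x in e].
Definition cross_edge (p : 'I_a * B) : {set join} := [set inl p.2; inr p.1].

Lemma base_edge2 x y : base_edge [set x; y] = [set inl x; inl y].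
Proof. by rewrite /base_edge imsetU !imset_set1. Qed.

Lemma base_edge_inj : injective base_edge.
Proof. by apply: imset_inj => x y []. Qed.

Lemma cross_edge_inj : injective cross_edge.
Proof.
case=> i x [j y] /setP e; move: (e (inl x)) (e (inr i)).
rewrite !inE !eqxx /= !orbF => /esym/eqP[->] /esym/eqP[->] //.
Qed.

Lemma base_edgeNcross e p : base_edge e <> cross_edge p.
Proof.
move/setP/(_ (inr p.1)); rewrite !inE eqxx orbT => /imsetP[x _]; discriminate.
Qed.

Lemma edges_join :
  edges join = [set base_edge e | e in edges B] :|: [set cross_edge p | p in setT].
Proof.
apply/setP=> f; apply/edgesP/setUP=> [[[x|i]] [[y|j]] [] //= xy ->|[]].
- by left; rewrite -base_edge2; apply/imset_f/mem_edges2.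
- by right; apply/imsetP; exists (j, x).
- by right; apply/imsetP; exists (i, y); rewrite // setUC.
- case/imsetP=> e /edgesP[x [y [xy ->]]] ->.
  by exists (inl x), (inl y); rewrite base_edge2.
- by case/imsetP=> [[i x]] _ ->; exists (inl x), (inr i).
Qed.

Lemma disjoint_base_cross (E : {set {set B}}) (P : {set 'I_a * B}) :
  [disjoint [set base_edge e | e in E] & [set cross_edge p | p in P]].
Proof.
apply/pred0P=> f /=; apply/negP=> /andP[/imsetP[e _ ->] /imsetP[p _]].
exact: base_edgeNcross.
Qed.

Lemma card_base_cross (E : {set {set B}}) (P : {set 'I_a * B}) :
  #|[set base_edge e | e in E] :|: [set cross_edge p | p in P]| = (#|E| + #|P|)%N.
Proof.
rewrite cardsU (disjoint_setI0 (disjoint_base_cross E P)) cards0 subn0.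
by rewrite !card_imset //; [exact: cross_edge_inj | exact: base_edge_inj].
Qed.

Lemma card_edges_join : #|edges join| = (#|edges B| + a * #|B|)%N.
Proof. by rewrite edges_join card_base_cross cardsT card_prod card_ord. Qed.

(** The edges of [B] form a triangle independent set: a triangle of the join containing two of them would
    have all three vertices in [B]. *)
Lemma alpha1_join : triangle_free B -> (#|edges B| <= alpha1 join)%N.
Proof.
move=> B3; rewrite -(card_imset _ base_edge_inj).
apply: (@leq_bigmax_cond _ _ (fun F : {set {set join}} => #|F|)).
apply/andP; split; first by rewrite edges_join subsetUl.
apply/forallP=> t; apply/implyP=> /andP[_ /forall_inP tadj].
have tri (x y : B) : inl x \in t -> inl y \in t -> x != y -> adj x y.
  by move=> xt yt xy; have /forall_inP/(_ _ yt)/implyP := tadj _ xt; exact.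
apply/card_le1_eqP=> f g; rewrite !inE.
case/andP=> /imsetP[e /edgesP[x [y [xy ->]]] {f}->].
rewrite base_edge2 => /andP[_]; rewrite subUset !sub1set => /andP[xt yt].
case/andP=> /imsetP[{}e /edgesP[x' [y' [xy' ->]]] {g}->].
rewrite base_edge2 => /andP[_]; rewrite subUset !sub1set => /andP[xt' yt'].
(* The base vertices of a triangle containing [x -- y] are [x] and [y]. *)
have third z : inl z \in t -> z = x \/ z = y.
  move=> zt; have [|zx] := eqVneq z x; first by left.
  have [|zy] := eqVneq z y; first by right.
  case: (B3 x y z) => //; first by apply: tri; rewrite // eq_sym.
  by apply: tri; rewrite // eq_sym.
have := adj_neq xy'.
by case: (third _ xt') => ->; case: (third _ yt') => ->; rewrite ?eqxx // setUC.
Qed.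

(** For a vertex [w] of the independent side, let [U w] be the set of the [u]
    whose edge to [w] is in the cover.  An edge of [B] outside [U w] forms with
    [w] a triangle that only this edge can cover, so the cover contains every
    edge induced on [~: U w].  Averaging the hypothesis for [~: U w] over the
    [a] choices of [w] bounds the size of the cover. *)
Lemma tau1_join (R : realFieldType) (L : R) :
    (0 < a)%N ->
    (forall S : {set B}, L <= (#|induced_edges S| + a * #|~: S|)%:R) ->
  L <= (tau1 join)%:R.
Proof.
move=> a_gt0 Lmin.
have [F /andP[_ /forallP Fcov] <-] := tau1_attained join.
pose F0 := [set e in edges B | base_edge e \in F].
pose P := [set p | cross_edge p \in F].
pose U w := [set u | (w, u) \in P].
have F0P : (#|F0| + #|P| <= #|F|)%N.
  rewrite -card_base_cross; apply/subset_leq_card/subUsetP; split.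
    by apply/subsetP=> f /imsetP[e]; rewrite inE => /andP[_ eF ->].
  by apply/subsetP=> f /imsetP[p]; rewrite inE => pF ->.
have PU : (#|P| = \sum_w #|U w|)%N by exact: card_slices.
have inF0 w : induced_edges (~: U w) \subset F0.
  apply/subsetP=> e; rewrite ![_ \in [set _ in edges B | _]]in_set.
  move=> /andP[eB]; rewrite eB /=.
  case/edgesP: eB => x [y [xy ->]]; rewrite subUset !sub1set !inE.
  move=> /andP[/negP xw /negP yw]; rewrite base_edge2.
  have := Fcov [set inl x; inl y; inr w].
  rewrite is_triangle3 //= => /card_gt0P[f]; rewrite inE => /andP[fF].
  rewrite inE edges_join => /andP[/setUP[]/imsetP[]].
    move=> e' /edgesP[x' [y' [xy' ->]]] ff; rewrite {}ff base_edge2 in fF *.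
    rewrite subUset !sub1set !inE !orbF => /andP[/orP[]/eqP[ex] /orP[]/eqP[ey]];
    move: fF xy'; rewrite ex ey ?adj_irrefl // setUC //.
  move=> [w' x'] _ ff; rewrite {}ff in fF *.
  rewrite subUset !sub1set !inE /= !orbF => /andP[/orP[]/eqP[ex] /eqP[ew]];
  by move: fF; rewrite ex ew.
have aR : 0 < a%:R :> R by rewrite ltr0n.
rewrite -(ler_pM2l aR) mulr_natl -[X in _ *+ X](card_ord a) -sumr_const.
apply: (@le_trans _ _ (\sum_(w < a) (#|F0| + a * #|U w|)%:R)).
  apply: ler_sum => w _; apply: le_trans (Lmin (~: U w)) _.
  by rewrite setCK ler_nat leq_add2r subset_leq_card.
rewrite -natr_sum -natrM ler_nat big_split /= sum_nat_const card_ord.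
by rewrite -big_distrr /= -PU -mulnDr leq_mul2l F0P orbT.
Qed.

End Join.

Lemma triangular_join (B : sgraph) (a : nat) :
  (0 < a)%N -> (forall x : B, exists y, adj x y) -> triangular (join B a).
Proof.
case: a => // a _ nbr; apply/forall_inP=> f fE.
suff [t tri ft] : exists2 t, is_triangle t & f \subset t.
  by apply/existsP; exists t; rewrite tri inE fE.
move: fE; rewrite edges_join => /setUP[]/imsetP[].
  move=> e /edgesP[x [y [xy ->]]] ->; rewrite base_edge2.
  by exists [set inl x; inl y; inr ord0]; rewrite ?subsetUl ?is_triangle3.
move=> [w x] _ ->; have [y xy] := nbr x.
exists [set inl x; inl y; inr w]; rewrite ?is_triangle3 //.
by rewrite subUset !sub1set !inE !eqxx ?orbT.
Qed.

(** * The parabola graph *)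

Section Parabola.
Variable F : finFieldType.
Implicit Types (u v w : F * F) (x y : F) (S : {set F * F}).

Definition parabola_step v x : F * F := (v.1 + x, v.2 + x ^+ 2).

(** The Cayley graph with generators [(x, x^2)] and [- (x, x^2)], [x != 0],
    written without quantifiers: [u != v] amounts to [x != 0] because the step
    of parameter [0] is the identity. *)
Definition parabola_adj u v :=
  (u != v) && ((v.2 - u.2 == (v.1 - u.1) ^+ 2) || (u.2 - v.2 == (u.1 - v.1) ^+ 2)).

Lemma parabola_adj_sym : symmetric parabola_adj.
Proof. by move=> u v; rewrite /parabola_adj eq_sym orbC. Qed.

Lemma parabola_adj_irrefl : irreflexive parabola_adj.
Proof. by move=> u; rewrite /parabola_adj eqxx. Qed.

Definition parabola_graph : sgraph := SGraph parabola_adj_sym parabola_adj_irrefl.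

Lemma parabola_stepP v u :
  v.2 - u.2 = (v.1 - u.1) ^+ 2 -> v = parabola_step u (v.1 - u.1).
Proof.
case: u v => u1 u2 [v1 v2] /= e; rewrite /parabola_step /= -e !addrA.
by congr (_, _); ring.
Qed.

Lemma parabola_step_eq v x : (v == parabola_step v x) = (x == 0).
Proof.
apply/eqP/eqP=> [/(congr1 fst)/= e|->]; last first.
  by case: v => a b; rewrite /parabola_step expr0n !addr0.
by apply: (addrI v.1); rewrite -e addr0.
Qed.

Lemma parabola_adjP u v :
  reflect (exists2 x, x != 0 & v = parabola_step u x \/ u = parabola_step v x)
          (parabola_adj u v).
Proof.
apply: (iffP andP) => [[uv]|[x x0 h]].
  by case/orP=> /eqP/parabola_stepP e; [exists (v.1 - u.1)|exists (u.1 - v.1)];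
    rewrite -?e; [rewrite -(parabola_step_eq u) -e|left
                 |rewrite -(parabola_step_eq v) -e eq_sym|right].
by case: h => ->;
  rewrite 1?(eq_sym (parabola_step _ _)) parabola_step_eq x0 /=; split=> //;
  apply/orP; [left|right]; apply/eqP; rewrite /parabola_step /=; ring.
Qed.

Lemma adj_parabola_step v x : x != 0 -> parabola_adj v (parabola_step v x).
Proof. by move=> x0; apply/parabola_adjP; exists x => //; left. Qed.

Hypothesis two_neq0 : 2 != 0 :> F.

(** Around a triangle the first coordinates change by [x], [y] and [x + y], all
    nonzero, and [x^2], [y^2] and [(x + y)^2] satisfy a linear relation with
    signs.  Up to the factor 2, each of the eight sign patterns forces one of
    [x y], [x (x + y)], [y (x + y)] or [x^2 + x y + y^2] to vanish. *)
Lemma parabola_triangle_free :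
  (forall x y, x ^+ 2 + x * y + y ^+ 2 = 0 -> x = 0) -> triangle_free parabola_graph.
Proof.
move=> no_root.
have diff u v : parabola_adj u v -> exists2 x, x != 0 &
    v.1 = u.1 + x /\ (v.2 = u.2 + x ^+ 2 \/ v.2 = u.2 - x ^+ 2).
  case/parabola_adjP=> x x0 [->|->]; first by exists x => //; split=> //; left.
  by exists (- x); rewrite ?oppr_eq0 //=; split; [ring|right; ring].
move=> u v w /diff[x x0 [v1 v2]] /diff[y y0 [w1 w2]] /diff[z z0 [z1 z2]].
have ez : z = x + y by apply: (addrI u.1); rewrite -z1 w1 v1 addrA.
have contra (p l r : F) : p != 0 -> l = r -> 2 * p = l - r -> False.
  move=> p0 -> /eqP; rewrite subrr mulf_eq0.
  by rewrite (negPf two_neq0) (negPf p0).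
have xyz : x ^+ 2 + x * y + y ^+ 2 != 0.
  by apply/eqP=> /no_root e; rewrite e eqxx in x0.
have {}v2 : v.2 - u.2 = x ^+ 2 \/ v.2 - u.2 = - x ^+ 2.
  by case: v2 => ->; [left|right]; ring.
have {}w2 : w.2 - v.2 = y ^+ 2 \/ w.2 - v.2 = - y ^+ 2.
  by case: w2 => ->; [left|right]; ring.
have {}z2 : v.2 - u.2 + (w.2 - v.2) = z ^+ 2 \/ v.2 - u.2 + (w.2 - v.2) = - z ^+ 2.
  by case: z2 => ->; [left|right]; ring.
have xy := mulf_neq0 x0 y0; have xz := mulf_neq0 x0 z0; have yz := mulf_neq0 y0 z0.
rewrite ez in xz yz.
case: v2 w2 z2 => -> [] -> []; rewrite ez => e.
- by apply: (contra _ _ _ xy (esym e)); ring.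
- by apply: (contra _ _ _ xyz e); ring.
- by apply: (contra _ _ _ yz (esym e)); ring.
- by apply: (contra _ _ _ xz e); ring.
- by apply: (contra _ _ _ xz (esym e)); ring.
- by apply: (contra _ _ _ yz e); ring.
- by apply: (contra _ _ _ xyz (esym e)); ring.
- by apply: (contra _ _ _ xy e); ring.
Qed.

(** Orienting an edge along the generator [(x, x^2)] makes edges inside [S]
    correspond one to one to pairs of a source and a parameter, since no
    generator [(x, x^2)] is the opposite of another one in odd characteristic. *)
Definition arcs S : {set (F * F) * F} :=
  [set p | [&& p.2 != 0, p.1 \in S & parabola_step p.1 p.2 \in S]].

Definition arc_edge (p : (F * F) * F) : {set parabola_graph} :=
  [set p.1; parabola_step p.1 p.2].

Lemma induced_edges_parabola S :
  induced_edges (B := parabola_graph) S = [set arc_edge p | p in arcs S].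
Proof.
apply/setP=> e; rewrite in_set; apply/andP/imsetP=> [[/edgesP[u [v [uv ->]]]]|].
  rewrite subUset !sub1set => /andP[uS vS].
  case/parabola_adjP: uv uS vS => x x0 [->|->] uS vS; last rewrite setUC.
    by exists (u, x); rewrite // inE /= x0 uS.
  by exists (v, x); rewrite // inE /= x0 vS.
case=> -[v x]; rewrite inE /= => /and3P[x0 vS wS] ->; split.
  exact/(mem_edges2 (B := parabola_graph))/adj_parabola_step.
by rewrite subUset !sub1set vS wS.
Qed.

Lemma parabola_step_inj v : injective (parabola_step v).
Proof. by move=> x y /(congr1 fst)/addrI. Qed.

Lemma arc_edge_inj S : {in arcs S &, injective arc_edge}.
Proof.
move=> [v x] [w y]; rewrite !inE /= => /and3P[x0 _ _] /and3P[y0 _ _].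
move=> /setP e; move: (e v) (e (parabola_step v x)); rewrite !inE !eqxx orbT /=.
have [<- _|vw /= /esym/eqP e1] := eqVneq v w.
  by rewrite eq_sym parabola_step_eq (negPf x0) => /esym/eqP/parabola_step_inj->.
rewrite -e1 [_ == v]eq_sym parabola_step_eq (negPf x0) orbF => /esym/eqP e2.
have yx : y = - x.
  move/(congr1 fst): e1; rewrite -e2 /= -addrA => /eqP.
  by rewrite addrC -subr_eq subrr eq_sym addrC addr_eq0 => /eqP.
move/(congr1 snd): e1; rewrite -e2 yx /= => e1.
have : 2 * x ^+ 2 == 0 by rewrite -(subrr v.2) {1}e1; apply/eqP; ring.
by rewrite mulf_eq0 (negPf two_neq0) expf_eq0 (negPf x0).
Qed.

Lemma card_induced_parabola S :
  #|induced_edges (B := parabola_graph) S| = #|arcs S|.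
Proof. by rewrite induced_edges_parabola card_in_imset //; apply: arc_edge_inj. Qed.

Lemma card_edges_parabola : #|edges parabola_graph| = (#|F| ^ 2 * #|F|.-1)%N.
Proof.
have -> : edges parabola_graph = induced_edges (B := parabola_graph) setT.
  by apply/setP=> e; rewrite [RHS]in_set subsetT andbT.
rewrite card_induced_parabola.
have -> : arcs setT = setX setT (~: [set 0]).
  by apply/setP=> -[v x]; rewrite !inE /= andbT.
by rewrite cardsX cardsT card_prod cardsC1.
Qed.

Definition hits S v := #|[set x | parabola_step v x \in S]|.

Lemma sum_hits S : (\sum_v hits S v = #|F| * #|S|)%N.
Proof.
under eq_bigr => v _ do rewrite /hits -sum1dep_card.
rewrite (exchange_big_dep predT) //= (eq_bigr (fun=> #|S|)) ?sum_nat_const //.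
move=> x _; rewrite sum1dep_card -[RHS](card_preimset (f := parabola_step^~ x)).
  by apply: eq_card => v; rewrite !inE.
by move=> [a b] [c d] [/addIr-> /addIr->].
Qed.

Definition hit_pairs S : {set (F * F) * (F * F)} :=
  [set p | (parabola_step p.1 p.2.1 \in S) && (parabola_step p.1 p.2.2 \in S)].

Lemma card_hit_pairs S : #|hit_pairs S| = (\sum_v hits S v ^ 2)%N.
Proof.
rewrite card_slices; apply: eq_bigr => v _; rewrite -mulnn -cardsX.
by apply: eq_card => -[x y]; rewrite !inE.
Qed.

(** Off the diagonal, [(v, x, y)] is recovered from the two points of [S] that it
    hits: their difference is [(x - y, (x - y) (x + y))], which determines [x]
    and [y], hence [v]. *)
Lemma sum_hits_sqr S : (\sum_v hits S v ^ 2 <= #|F| * #|S| + #|S| ^ 2)%N.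
Proof.
rewrite -card_hit_pairs.
rewrite -(cardsID [set p : (F * F) * (F * F) | p.2.1 == p.2.2]) leq_add //.
  rewrite -sum_hits card_slices; apply: leq_sum => v _.
  rewrite /hits -(card_imset _ (f := fun x => (x, x))); last by move=> x y [].
  apply/subset_leq_card/subsetP=> -[x y]; rewrite !inE /= => /andP[/andP[xS _] /eqP<-].
  by apply/imsetP; exists x; rewrite ?inE.
rewrite -mulnn -cardsX.
rewrite -(card_in_imset
  (f := fun p => (parabola_step p.1 p.2.1, parabola_step p.1 p.2.2))).
  apply/subset_leq_card/subsetP=> _ /imsetP[p + ->].
  by rewrite !inE => /andP[].
move=> [[v1 v2] [x y]] [[w1 w2] [x' y']].
rewrite !inE /= => /andP[xy _] /andP[xy' _] [e1 e2 e3 e4].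
have exy : x - y = x' - y'.
  have -> : x - y = (v1 + x) - (v1 + y) by ring.
  by rewrite e1 e3; ring.
have sxy : x + y = x' + y'.
  apply: (mulfI (x := x - y)); first by rewrite subr_eq0.
  have -> : (x - y) * (x + y) = (v2 + x ^+ 2) - (v2 + y ^+ 2) by ring.
  by rewrite e2 e4 exy; ring.
have ex : x = x'.
  apply: (mulfI two_neq0).
  have -> : 2 * x = (x - y) + (x + y) by ring.
  by rewrite exy sxy; ring.
subst x'; move/addrI/oppr_inj: exy => ?; subst y'.
by move/addIr: e1 => ->; move/addIr: e2 => ->.
Qed.

(** Each [v] in [S] is hit by its own translate at parameter [0]; the other hits
    are arcs. *)
Lemma sum_hits_in S : (\sum_(v in S) hits S v = #|S| + #|arcs S|)%N.
Proof.
have -> : #|arcs S| = (\sum_(v in S) #|[set x | x != 0%R & parabola_step v x \in S]|)%N.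
  rewrite card_slices [RHS]big_mkcond; apply: eq_bigr => v _.
  case: ifP => vS; first by apply: eq_card => x; rewrite !inE /= vS.
  by apply/eqP; rewrite cards_eq0; apply/eqP/setP=> x; rewrite !inE vS andbF.
rewrite -sum1_card -big_split; apply: eq_bigr => v vS /=.
rewrite /hits (cardsD1 0) inE /parabola_step expr0n !addr0 -surjective_pairing vS.
by congr (1 + _)%N; apply: eq_card => x; rewrite !inE.
Qed.

(** By the first two moments, the deviations [q * hits S v - |S|] have sum of
    squares at most [q^3 |S|] over the plane, hence over [S]; by
    Cauchy--Schwarz their sum over [S] is at least [- q sqrt q |S|]. *)
Lemma sum_hits_in_ge (R : rcfType) S :
  #|S|%:R ^+ 2 / #|F|%:R - #|S|%:R * Num.sqrt #|F|%:R <=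
    \sum_(v in S) (hits S v)%:R :> R.
Proof.
set q : R := #|F|%:R; set s : R := #|S|%:R; set r := Num.sqrt q.
pose h v : R := (hits S v)%:R.
have q_gt0 : 0 < q by rewrite ltr0n; apply/card_gt0P; exists 0.
have r_gt0 : 0 < r by rewrite sqrtr_gt0.
have rr : r ^+ 2 = q by rewrite sqr_sqrtr ?ltW.
have var : \sum_v (q * h v - s) ^+ 2 <= q ^+ 3 * s.
  have h1 : \sum_v h v = q * s by rewrite -natr_sum sum_hits natrM.
  have h2 : \sum_v h v ^+ 2 <= q * s + s ^+ 2.
    rewrite -natrX -natrM -natrD.
    by under eq_bigr => v _ do rewrite -natrX; rewrite -natr_sum ler_nat sum_hits_sqr.
  rewrite (eq_bigr (fun v => q ^+ 2 * h v ^+ 2 - 2 * q * s * h v + s ^+ 2)); last first.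
    by move=> v _; ring.
  rewrite !big_split /= sumrN -!mulr_sumr h1 sumr_const card_prod.
  rewrite -[s *+ _]mulr_natl natrM -/q.
  by have := ler_wpM2l (exprn_ge0 2 (ltW q_gt0)) h2; nra.
(* Cauchy--Schwarz in the form 0 <= (deviation + t)^2, for the optimal t. *)
pose t := q * r.
have t_gt0 : 0 < t by rewrite mulr_gt0.
have tt : t ^+ 2 = q ^+ 3 by rewrite exprMn rr; ring.
have : 0 <= \sum_(v in S) (q * h v - s + t) ^+ 2.
  by apply: sumr_ge0 => v _; rewrite sqr_ge0.
have varS : \sum_(v in S) (q * h v - s) ^+ 2 <= q ^+ 3 * s.
  apply: le_trans var; rewrite [leRHS](bigID (mem S)) /= lerDl.
  by apply: sumr_ge0 => v _; rewrite sqr_ge0.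
have -> : \sum_(v in S) (q * h v - s + t) ^+ 2 =
    \sum_(v in S) (q * h v - s) ^+ 2 +
      (2 * t * q * \sum_(v in S) h v + s * (t ^+ 2 - 2 * t * s)).
  rewrite mulr_sumr [s * _]mulr_natl -sumr_const -!big_split /=.
  by apply: eq_bigr => v _; ring.
move=> sq.
have : 0 <= 2 * t * (q * (\sum_(v in S) h v - (s ^+ 2 / q - s * r))).
  have -> : 2 * t * (q * (\sum_(v in S) h v - (s ^+ 2 / q - s * r))) =
      q ^+ 3 * s + (2 * t * (q * \sum_(v in S) h v) + (t ^+ 2 - 2 * t * s) * s).
    rewrite -tt /t; field; exact: lt0r_neq0.
  by move: sq varS; lra.
by rewrite pmulr_rge0 ?mulr_gt0 // pmulr_rge0 // subr_ge0.
Qed.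

End Parabola.

(** * Fields without primitive cube roots of unity *)

(** Otherwise [x] and [y] have the same cube.  If [q = 3 k + 2] then every
    nonzero [z] satisfies [z = z^q = z^(3 k) z^2], so [z] is the inverse of
    [z^(3 k)]: cubing is injective and [x = y], whence [3 x^2 = 0]. *)
Lemma no_cube_root_of_unity (F : finFieldType) :
    3 != 0 :> F -> (#|F| %% 3 = 2)%N ->
  forall x y : F, x ^+ 2 + x * y + y ^+ 2 = 0 -> x = 0.
Proof.
move=> three_neq0 q3 x y xy0; apply/eqP/negPn/negP=> x0.
have xy3 : x ^+ 3 = y ^+ 3.
  apply/eqP; rewrite -subr_eq0.
  have -> : x ^+ 3 - y ^+ 3 = (x - y) * (x ^+ 2 + x * y + y ^+ 2) by ring.
  by rewrite xy0 mulr0.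
have y0 : y != 0.
  by apply: contraNneq x0 => y0; move/eqP: xy3; rewrite y0 expr0n expf_eq0.
pose c := x ^+ 3 ^+ (#|F| %/ 3).
have unit_inv z : z ^+ 3 = x ^+ 3 -> z != 0 -> c * z = 1.
  move=> z3 z0; apply: (mulIf z0); rewrite mul1r -[RHS]expf_card.
  by rewrite (divn_eq #|F| 3) q3 exprD mulnC exprM z3 -mulrA.
have c0 : c != 0 by rewrite !expf_neq0.
have eyx : x = y by apply: (mulfI c0); rewrite !unit_inv.
move/eqP: xy0; have -> : x ^+ 2 + x * y + y ^+ 2 = 3 * x ^+ 2 by rewrite -eyx; ring.
by rewrite mulf_eq0 (negPf three_neq0) expf_eq0 (negPf x0).
Qed.

(** Order [5^(2N+1)] is congruent to 2 modulo 3, and 2 and 3 are nonzero in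
    characteristic 5. *)
Lemma large_field N : {F : finFieldType | [/\ (N < #|F|)%N, 2 != 0 :> F &
  forall x y : F, x ^+ 2 + x * y + y ^+ 2 = 0 -> x = 0]}.
Proof.
have [//|F F5 cardF] := @PrimePowerField 5 N.*2.+1 isT _.
have e5 : 5%:R = 0 :> F by rewrite (pcharf0 F5).
have e2 : 2 != 0 :> F.
  apply/eqP=> e2; have /eqP := oner_neq0 F; apply.
  have -> : 1 = 5%:R - 2 * 2 :> F by ring.
  by rewrite e5 e2 mul0r subr0.
exists F; split=> //.
  rewrite cardF; apply: leq_trans (ltn_expl N (isT : 1 < 5)%N) _.
  by rewrite leq_exp2l // -addnn -addnS leq_addr.
apply: no_cube_root_of_unity.
  apply/eqP=> e3; have /eqP := oner_neq0 F; apply.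
  have -> : 1 = 3 * 2 - 5%:R :> F by ring.
  by rewrite e5 e3 mul0r subr0.
by rewrite cardF expnS -mul2n expnM -modnMmr -modnXm /= exp1n.
Qed.

(** * Optimisation *)

(** For [|S| = x q^2] the right-hand side is, up to the error
    [q^2 (sqrt q + 1)], at least [q^2 ((q - 1) x^2 + a (1 - x))], a quadratic
    polynomial in [x] with minimum at [x = a / (2 (q - 1))]. *)
Lemma parabola_weighted_bound (R : rcfType) (F : finFieldType) (S : {set F * F}) (a : R) :
  2 != 0 :> F -> (1 < #|F|)%N ->
  (#|F|%:R ^+ 2) * (a - a ^+ 2 / (4 * (#|F|%:R - 1)) - Num.sqrt #|F|%:R - 1) <=
  #|induced_edges (B := parabola_graph F) S|%:R + a * #|~: S|%:R.
Proof.
move=> F2 F1; have := sum_hits_in_ge F2 R S.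
rewrite -natr_sum sum_hits_in // card_induced_parabola // natrD.
set q : R := #|F|%:R; set s : R := #|S|%:R; set e : R := #|_|%:R.
set r := Num.sqrt q => ineq.
have q1 : 1 < q by rewrite ltr1n.
have -> : #|~: S|%:R = q ^+ 2 - s :> R.
  apply/eqP; rewrite eq_sym subr_eq -natrD cardsCs setCK.
  by rewrite subnK ?max_card // card_prod natrM.
have s0 : 0 <= s by rewrite ler0n.
have s_le : s <= q ^+ 2.
  by rewrite -natrX ler_nat -mulnn -card_prod max_card.
have r0 : 0 <= r by rewrite sqrtr_ge0.
pose x := s / q ^+ 2; pose Q := q - 1.
have q20 : 0 < q ^+ 2 by rewrite exprn_gt0 //; lra.
have sx : s = q ^+ 2 * x by rewrite mulrC divfK ?lt0r_neq0.
have x0 : 0 <= x by rewrite divr_ge0 // ltW.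
have x1 : x <= 1 by rewrite ler_pdivrMr // mul1r.
have square : a - a ^+ 2 / (4 * Q) <= x ^+ 2 * Q + a - a * x.
  rewrite -subr_ge0.
  have -> : x ^+ 2 * Q + a - a * x - (a - a ^+ 2 / (4 * Q)) = Q * (x - a / (2 * Q)) ^+ 2.
    by field; rewrite /Q; lra.
  by rewrite mulr_ge0 ?sqr_ge0 // /Q; lra.
have per_vertex : a - a ^+ 2 / (4 * Q) - r - 1 <= x ^+ 2 * q - x * r - x + a * (1 - x).
  have xr : x * r <= r by rewrite ler_piMl.
  have := sqr_ge0 x.
  by move: square; rewrite /Q; lra.
have scaled := ler_wpM2l (ltW q20) per_vertex.
apply: le_trans scaled _.
have sq : s ^+ 2 / q = q ^+ 2 * (x ^+ 2 * q) by rewrite sx; field; lra.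
by move: ineq; rewrite sq sx; lra.
Qed.

Theorem corollary3p6 (R : realType) :
  exists gamma0 : R, 0 < gamma0 /\
    forall gamma : R, 0 < gamma -> gamma < gamma0 ->
      exists H : sgraph,
        [/\ triangular H,
            (0 < #|edges H|)%N,
            (tau1 H)%:R / #|edges H|%:R >= (3 - Num.sqrt 5) / 2 - gamma
              /\ (3 - Num.sqrt 5) / 2 - gamma > 38 / 100
          & (alpha1 H)%:R / #|edges H|%:R >= 1 / Num.sqrt 5 - gamma
              /\ 1 / Num.sqrt 5 - gamma > 44 / 100].
Proof.
set r5 : R := Num.sqrt 5.
have r5sq : r5 ^+ 2 = 5 by rewrite sqr_sqrtr ?ler0n.
have r5_ge0 : 0 <= r5 by rewrite sqrtr_ge0.
have r5_gt : 20 / 9 < r5 by nra.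
have r5_lt : r5 < 179 / 80 by nra.
have r5V : 1 / r5 = r5 / 5 by rewrite -r5sq; field; lra.
exists (1 / 1000); split=> [|g g_gt0 g_lt]; first by lra.
(* The order is chosen to make the total error (sqrt q + 2) / (q - 1) at most g. *)
have [F [qN F2 Froot]] := large_field (Num.bound ((4 / g) ^+ 2)).
pose q : R := #|F|%:R; pose r := Num.sqrt q.
have r_ge0 : 0 <= r by rewrite sqrtr_ge0.
have rr : r ^+ 2 = q by rewrite sqr_sqrtr ?ler0n.
have r_gt : 4 / g < r.
  have g4 : 0 < 4 / g by rewrite divr_gt0.
  rewrite -(ltr_pXn2r (n := 2)) ?nnegrE ?(ltW g4) // rr.
  apply: lt_trans (_ : (Num.bound ((4 / g) ^+ 2))%:R < q); last by rewrite ltr_nat.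
  by apply: le_lt_trans (archi_boundP _); rewrite ?exprn_ge0 // ltW.
have gr : 4 < g * r by rewrite mulrC -ltr_pdivrMr.
have r_gt4 : 4 < r by nra.
have err : r + 2 <= g * (q - 1).
  by have := ler_wpM2l r_ge0 (ltW gr); rewrite -rr; lra.
have q1 : 16 < q by rewrite -rr; nra.
have qN1 : (#|F|%:R : R) = #|F|.-1%:R + 1.
  by rewrite -[in LHS](prednK (ltn_trans _ qN)) // -natr1.
(* With m = n (q - 1), this makes a n equal to b m up to rounding. *)
pose b := r5 - 1.
pose a := Num.truncn ((q - 1) * b).
have [a_le a_gt] : a%:R <= (q - 1) * b /\ (q - 1) * b < a%:R + 1 :> R.
  have /truncn_itv/andP[] : 0 <= (q - 1) * b by apply: mulr_ge0; rewrite /b; lra.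
  by rewrite -natr1.
have a_gt1 : 1 <= a%:R :> R by move: a_gt; rewrite /b; nra.
have a_gt0 : (0 < a)%N by rewrite -(ler_nat R).
pose B := parabola_graph F.
pose n : R := q ^+ 2.
have n_gt0 : 0 < n by rewrite exprn_gt0; lra.
have EB : #|edges B|%:R = n * (q - 1) :> R.
  by rewrite card_edges_parabola // natrM natrX /n /q qN1 addrK.
have EH : #|edges (join B a)|%:R = n * (q - 1 + a%:R) :> R.
  by rewrite card_edges_join natrD natrM EB [#|B|]card_prod natrM -/q /n; ring.
have EH_gt0 : 0 < n * (q - 1 + a%:R) by apply: mulr_gt0 => //; lra.
have tauH : n * (a%:R - a%:R ^+ 2 / (4 * (q - 1)) - r - 1) <= (tau1 (join B a))%:R.
  apply: tau1_join => // S; rewrite natrD natrM; apply: parabola_weighted_bound => //.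
  by rewrite -(ltr_nat R); lra.
have alphaH : n * (q - 1) <= (alpha1 (join B a))%:R.
  by rewrite -EB ler_nat; apply/alpha1_join/parabola_triangle_free.
have r5q : r5 ^+ 2 * (q - 1) = 5 * (q - 1) by rewrite r5sq.
have gq : 0 <= g * (q - 1) * (r5 - 1) by rewrite !mulr_ge0 //; lra.
exists (join B a); split.
- apply: triangular_join => // u; exists (parabola_step u 1).
  by apply: adj_parabola_step; exact: oner_neq0.
- by rewrite -(ltr_nat R) EH.
- split; last by lra.
  rewrite EH ler_pdivlMr //; apply: le_trans tauH; rewrite mulrCA ler_pM2l //.
  (* Rounding down costs at most 1 in the linear term and nothing in the other. *)
  have loss : b * (q - 1) - b ^+ 2 / 4 * (q - 1) - 1 <= a%:R - a%:R ^+ 2 / (4 * (q - 1)).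
    have : a%:R ^+ 2 / (4 * (q - 1)) <= b ^+ 2 / 4 * (q - 1).
      rewrite ler_pdivrMr; last by lra.
      have -> : b ^+ 2 / 4 * (q - 1) * (4 * (q - 1)) = ((q - 1) * b) ^+ 2 by field.
      by rewrite lerXn2r // nnegrE; lra.
    by lra.
  have c_ge0 : 0 <= (3 - r5) / 2 - g by lra.
  have := ler_wpM2l c_ge0 a_le.
  by move: loss r5q gq; rewrite /b; lra.
- split; last by lra.
  rewrite EH ler_pdivlMr //; apply: le_trans alphaH; rewrite mulrCA ler_pM2l //.
  have c_ge0 : 0 <= 1 / r5 - g by lra.
  have := ler_wpM2l c_ge0 a_le.
  by move: r5q gq; rewrite r5V /b; lra.
Qed.
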